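(* For every integer $k\ge1$, every $k$-letter graph is a $k$-thin graph.
   Context: A graph $G=(\{1,\dots,n\},E)$ is a $k$-letter graph if there exist a word $w\in\{1,\dots,k\}^n$ and a set $\mathcal{D}\subseteq\{1,\dots,k\}^2$ such that for all $1\le i<j\le n$: $\{i,j\}\in E$ iff $w[i]w[j]\in\mathcal{D}$ (graphs isomorphic to such graphs are also $k$-letter graphs). A graph $G=(V,E)$ is $k$-thin if its vertices admit a linear ordering $v_1<\dots<v_n$ and a partition $V=V^1\uplus\dots\uplus V^k$ such that for all $a<b<c$ with $v_a,v_b$ in the same part and $\{v_a,v_c\}\in E$, also $\{v_b,v_c\}\in E$. *)

(* Defs.v *)
From mathcomp Require Import all_boot.

Set Implicit Arguments.
Unset Strict Implicit.
Unset Printing Implicit Defensive.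

Record sgraph (V : finType) := SGraph {
  adj :> rel V;
  adj_sym : symmetric adj;
  adj_irrefl : irreflexive adj
}.

Definition graph_iso (V W : finType) (G : sgraph V) (H : sgraph W) : Prop :=
  exists2 f : V -> W, bijective f & forall x y, adj H (f x) (f y) = adj G x y.

(* Vertices and letters are numbered from 0, so {1,...,n} is 'I_n. *)
Definition word_letter_graph (k n : nat) (G : sgraph 'I_n) : Prop :=
  exists (w : n.-tuple 'I_k) (D : {set 'I_k * 'I_k}),
    forall i j : 'I_n, i < j ->
      (adj G i j <-> (tnth w i, tnth w j) \in D).

Definition letter_graph (k : nat) (V : finType) (G : sgraph V) : Prop :=
  exists (n : nat) (H : sgraph 'I_n), word_letter_graph k H /\ graph_iso H G.

(* The bijection v lists the vertices in increasing order.  The parts P i of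
   the partition may be empty, as letters may be unused in a word. *)
Definition thin (k : nat) (V : finType) (G : sgraph V) : Prop :=
  exists (v : 'I_#|V| -> V) (P : 'I_k -> {set V}),
    [/\ bijective v,
        forall x : V, exists! i : 'I_k, x \in P i &
        forall a b c : 'I_#|V|, a < b -> b < c ->
          (exists i : 'I_k, v a \in P i /\ v b \in P i) ->
          adj G (v a) (v c) -> adj G (v b) (v c)].

(* Main.v *)
Require Import Defs.
From mathcomp Require Import all_boot.

Set Implicit Arguments.
Unset Strict Implicit.
Unset Printing Implicit Defensive.

(* The word itself gives the order, and the classes of equal letters give the
   partition: for a < b < c with w[a] = w[b], adjacency to c depends only on
   the pair (w[a], w[c]) = (w[b], w[c]). *)
Theorem theorem15 (k : nat) (hk : 1 <= k) (V : finType) (G : sgraph V) :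
  letter_graph k G -> thin k G.
Proof.
move=> [n [H [[w [D wD]] [f bij_f fH]]]].
(* [thin] indexes the order by ['I_#|V|], the word by ['I_n]; [cast_ord] bridges the two. *)
have eq_n : #|V| = n by rewrite -(bij_eq_card bij_f) card_ord.
have [g fK gK] := bij_f.
(* The isomorphism [f] sends word positions to vertices, so [g x] is the position of [x] and
   [tnth w (g x)] its letter. *)
exists (f \o cast_ord eq_n), (fun i => [set x | tnth w (g x) == i]); split.
- apply: bij_comp bij_f _.
  by exists (cast_ord (esym eq_n)); [exact: cast_ordK | exact: cast_ordKV].
- by move=> x; exists (tnth w (g x)); split=> [|i]; rewrite inE // => /eqP.
- move=> a b c lt_ab lt_bc [i []]; rewrite !inE /= !fK => /eqP wa /eqP wb.
  have lt_ac := ltn_trans lt_ab lt_bc.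
  (* [cast_ord] keeps the underlying number, so [lt_ac] and [lt_bc] apply as they are. Both [wa] and
     [wb] name the letter [i], so the pair found in [D] for [a], [c] is also the pair for [b],
     [c]. *)
  rewrite !fH => /(wD (cast_ord eq_n a) (cast_ord eq_n c) lt_ac).
  by rewrite wa -wb => /(wD (cast_ord eq_n b) (cast_ord eq_n c) lt_bc).
Qed.
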